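(* The following 58 lower bounds on $K_q(n,R)$ hold: $K_{6}(8,2)\ge 2367$; $K_{6}(9,2)\ge 10965$; $K_{6}(9,3)\ge 926$; $K_{6}(10,3)\ge 3836$; $K_{6}(10,4)\ge 441$; $K_{7}(7,2)\ge 1081$; $K_{7}(8,2)\ge 5631$; $K_{7}(8,3)\ge 471$; $K_{7}(9,2)\ge 30562$; $K_{7}(9,3)\ge 2143$; $K_{7}(10,2)\ge 170632$; $K_{8}(8,2)\ge 12033$; $K_{8}(8,3)\ge 856$; $K_{8}(9,4)\ge 429$; $K_{9}(8,2)\ge 23642$; $K_{9}(8,3)\ge 1464$; $K_{9}(9,3)\ge 8685$; $K_{9}(9,4)\ge 722$; $K_{9}(10,3)\ge 54600$; $K_{10}(7,2)\ge 5824$; $K_{10}(8,2)\ge 43423$; $K_{10}(9,2)\ge 337394$; $K_{10}(9,4)\ge 1160$; $K_{10}(10,2)\ge 2699348$; $K_{10}(10,4)\ge 6915$; $K_{11}(7,2)\ge 9193$; $K_{11}(8,2)\ge 75448$; $K_{12}(8,2)\ge 125156$; $K_{12}(8,3)\ge 5605$; $K_{13}(6,2)\ge 2233$; $K_{13}(7,2)\ge 20545$; $K_{13}(8,2)\ge 199633$; $K_{13}(8,3)\ge 8193$; $K_{14}(6,2)\ge 2964$; $K_{14}(7,2)\ge 29404$; $K_{14}(8,2)\ge 307909$; $K_{15}(6,2)\ge 3862$; $K_{15}(8,2)\ge 461294$; $K_{16}(6,2)\ge 4951$; $K_{16}(7,2)\ge 56237$; $K_{16}(8,2)\ge 673723$;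 $K_{17}(7,2)\ge 75559$; $K_{17}(8,2)\ge 962145$; $K_{17}(8,3)\ge 29652$; $K_{17}(8,4)\ge 1464$; $K_{18}(6,2)\ge 7804$; $K_{18}(8,2)\ge 1346931$; $K_{19}(6,2)\ge 9624$; $K_{19}(7,2)\ge 130081$; $K_{19}(7,3)\ge 4282$; $K_{19}(8,2)\ge 1852296$; $K_{20}(7,2)\ge 167204$; $K_{20}(7,3)\ge 5215$; $K_{20}(8,2)\ge 2506759$; $K_{21}(6,2)\ge 14201$; $K_{21}(7,3)\ge 6294$; $K_{21}(8,2)\ge 3343629$; $K_{21}(8,3)\ge 82595$.
   Context: For integers $q\ge 2$ and $n\ge 1$, let $\mathbb{Z}_q=\{0,\dots,q-1\}$ and let $\mathbb{Z}_q^n$ be the set of words of length $n$ over $\mathbb{Z}_q$, equipped with the Hamming distance $d(x,y)=\#\{i: x_i\ne y_i\}$. A code $C\subseteq\mathbb{Z}_q^n$ has covering radius at most $R$ if for every word $w\in\mathbb{Z}_q^n$ there is a codeword $c\in C$ with $d(w,c)\le R$. Define $K_q(n,R)=\min\{|C| : C\subseteq\mathbb{Z}_q^n \text{ has covering radius at most } R\}$. *)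

(* Defs.v *)
From mathcomp Require Import all_boot.

Set Implicit Arguments.
Unset Strict Implicit.
Unset Printing Implicit Defensive.

Definition word (q n : nat) := {ffun 'I_n -> 'I_q}.

Definition hamming (q n : nat) (x y : word q n) : nat :=
  #|[set i | x i != y i]|.

Definition covering (q n R : nat) (C : {set word q n}) : bool :=
  [forall w : word q n, exists c in C, hamming w c <= R].

(* The seed [set: word q n] of the minimum is itself a covering code (see
   covering_setT), so K is the minimum over a nonempty family; covering_K and
   K_le restate this. *)
Definition K (q n R : nat) : nat :=
  #|[arg min_(C < [set: word q n] | covering R C) #|C|]|.

Lemma covering_setT (q n R : nat) : covering R [set: word q n].
Proof.
apply/forallP=> w; apply/existsP; exists w; rewrite inE /hamming.
by rewrite (_ : [set i | w i != w i] = set0) ?cards0 //;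
  apply/setP=> i; rewrite !inE eqxx.
Qed.

Lemma covering_K (q n R : nat) :
  exists2 C : {set word q n}, covering R C & #|C| = K q n R.
Proof.
by rewrite /K; case: arg_minnP => [|C covC _]; [exact: covering_setT | exists C].
Qed.

Lemma K_le (q n R : nat) (C : {set word q n}) : covering R C -> K q n R <= #|C|.
Proof.
by rewrite /K; case: arg_minnP => [|D _ minD]; [exact: covering_setT | exact: minD].
Qed.

(* Main.v *)
Require Import Defs.
From Stdlib Require Import BinNat.
From mathcomp Require Import all_boot.
From mathcomp Require Import zify.

Set Implicit Arguments.
Unset Strict Implicit.
Unset Printing Implicit Defensive.

(** Every word is covered, so the [|C|] balls of radius [R] exceed the sphere
    covering bound exactly by the total excess, the sum over all words [y] of
    the number of codewords covering [y] minus one. The point is that a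
    positive amount of excess is unavoidable.

    Fix a pair [I] of coordinates and a plane in direction [I], that is, the
    [q * q] words with given values outside [I]. A codeword at distance [R - 1]
    from the plane, measured outside [I], covers a row and a column of the
    plane, and one at distance at most [R - 2] covers all of it. Any two
    crosses meet, and in at least two points, because the row of one meets the
    column of the other. So if [psi] is a codeword closest to the plane, every
    other codeword [c] at outside distance [R - 1] or [R - 2] shares with [psi]
    at least two covered points of the plane, and these can be taken at distance
    exactly [R] from [c] ([plane_overlap]). Summing over the [q ^ (n - 2)]
    parallel planes bounds the surplus in direction [I] from below
    ([plane_surplus]).

    Conversely, a surplus codeword [c] of a word [y] at distance exactly [R] is
    seen only in the directions [I] that meet the [R] coordinates where [c] and
    [y] differ; there are ['C(n, 2) - 'C(n - R, 2)] of them. Comparing [psi]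
    with a codeword nearest to [y] shows that in all directions together the
    surplus at [y] is at most that number times the excess at [y]
    ([point_surplus]).

    Adding up both estimates gives a linear inequality for [|C|]
    ([covering_bound]), which implies each of the listed bounds by a
    computation with binary integers ([K_ge]). *)

(** * Counting words *)

(** The number of pairs of coordinates that meet a given set of [R] coordinates. *)
Definition pairs_meeting n R := 'C(n, 2) - 'C(n - R, 2).

(** The number of planes in a given direction at outside distance [R - 2] or
    [R - 1] from a given word. *)
Definition near_planes q n R :=
  'C(n - 2, R - 2) * q.-1 ^ (R - 2) + 'C(n - 2, R - 1) * q.-1 ^ (R - 1).

Section Counting.
Variables (q n : nat).
Implicit Types (w x y c : word q n) (B I S : {set 'I_n}).

Definition dist B x y := #|[set l in B | x l != y l]|.

Lemma dist_hamming x y : hamming x y = dist setT x y.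
Proof. by apply: eq_card => l; rewrite !inE. Qed.

Lemma hamming_split I x y : hamming x y = dist I x y + dist (~: I) x y.
Proof.
rewrite /hamming /dist -(cardsID I [set i | x i != y i]); congr addn.
  by apply: eq_card => l; rewrite !inE andbC.
by apply: eq_card => l; rewrite !inE.
Qed.

Lemma card_word_family (F : 'I_n -> pred 'I_q) :
  #|[set w : word q n | [forall l, w l \in F l]]| = \prod_l #|F l|.
Proof.
have E (w : word q n) : [forall l, w l \in F l] = (w \in family F).
  exact/forallP/familyP.
rewrite cardsE (eq_card (B := family F)) => [|w]; last exact: E.
by rewrite card_family foldrE big_map big_enum.
Qed.

Lemma card_words_off B (o : word q n) :
  #|[set w : word q n | [forall l in ~: B, w l == o l]]| = q ^ #|B|.
Proof.
have -> : [set w : word q n | [forall l in ~: B, w l == o l]] =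
  [set w : word q n | [forall l,
     w l \in if l \in B then predT else pred1 (o l)]].
  apply/setP=> w; rewrite !inE; apply: eq_forallb => l.
  by rewrite inE; case: (l \in B).
rewrite card_word_family (bigID (mem B)) /= -[RHS]muln1; congr (_ * _).
  under eq_bigr => l lB do rewrite lB card_ord.
  by rewrite prod_nat_const.
by rewrite big1 // => l /negPf ->; rewrite card1.
Qed.

(** Classify the words by the set [S] of coordinates of [B] where they differ
    from [c]: each [S] of size [d] allows [q.-1] values at each of its
    elements and forces all other coordinates. Both the balls and the families
    of parallel planes are counted with this. *)
Lemma card_sphere B (o : word q n) c d :
  #|[set w : word q n | [forall l in ~: B, w l == o l] & dist B w c == d]| =
  'C(#|B|, d) * q.-1 ^ d.
Proof.
rewrite -cards_draws -sum1_card.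
rewrite (partition_big (fun w : word q n => [set l in B | w l != c l])
  (fun S : {set 'I_n} => (S \subset B) && (#|S| == d))); last first.
  move=> w; rewrite inE => /andP[_ ->]; rewrite andbT.
  by apply/subsetP => l; rewrite inE => /andP[].
rewrite -sum_nat_const; apply: eq_big => [S|S /andP[SB /eqP Sd]].
  by rewrite inE.
rewrite sum1dep_card.
have -> : [set w : word q n | (w \in [set w : word q n |
       [forall l in ~: B, w l == o l] & dist B w c == d]) && ([set l in B | w l != c l] == S)] =
  [set w : word q n | [forall l, w l \in if l \in S then predC1 (c l)
     else if l \in B then pred1 (c l) else pred1 (o l)]].
  apply/setP=> w; rewrite !inE; apply/andP/forallP.
    case=> /andP[/forallP off _] /eqP <- l; have := off l.
    by rewrite !inE; case: (l \in B) => //=; case: eqP => [->|/eqP]; rewrite !inE.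
  move=> wF.
  have E : [set l in B | w l != c l] = S.
    apply/setP=> l; rewrite inE; have := wF l; have := subsetP SB l.
    case: (l \in S) => [->//|_]; case: (l \in B) => //.
    by rewrite inE => ->.
  rewrite /dist E Sd eqxx andbT; split=> //; apply/forallP=> l.
  rewrite inE; apply/implyP=> lB; have := wF l.
  by rewrite (negPf lB); have := contra (subsetP SB l) lB => /negPf ->.
rewrite card_word_family (bigID (mem S)) /= -[RHS]muln1; congr (_ * _).
  under eq_bigr => l lS do rewrite lS cardC1 card_ord.
  by rewrite prod_nat_const Sd.
by rewrite big1 // => l /negPf ->; case: ifP; rewrite card1.
Qed.

Lemma dist_sum B x y : dist B x y = \sum_(l in B) (x l != y l).
Proof.
by rewrite /dist -sum1dep_card big_mkcondr; apply: eq_bigr => l _; case: eqP.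
Qed.

Lemma sum_ball R c : \sum_(y : word q n) (hamming y c <= R) =
  \sum_(d < R.+1) 'C(n, d) * q.-1 ^ d.
Proof.
rewrite -big_mkcond /=.
rewrite (partition_big (fun y => inord (hamming y c) : 'I_R.+1) predT) //=.
apply: eq_bigr => d _; rewrite sum1dep_card.
have := card_sphere setT c c d; rewrite cardsT card_ord => <-.
apply: eq_card => y; rewrite !inE -dist_hamming.
rewrite (_ : [forall l in _, _] = true); last by apply/forallP=> l; rewrite !inE.
have [yR|yR] /= := leqP (hamming y c) R; first by rewrite -val_eqE /= inordK.
by symmetry; apply/negbTE/(contraL _ yR) => /eqP ->; rewrite -leqNgt -ltnS.
Qed.

Lemma card_pairs_meeting S :
  #|[set I : {set 'I_n} | #|I| == 2 & ~~ [disjoint I & S]]| =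
  pairs_meeting n #|S|.
Proof.
rewrite /pairs_meeting.
have -> : n - #|S| = #|~: S| by rewrite [RHS]cardsCs setCK card_ord.
rewrite -[n in 'C(n, 2)]card_ord -cardsT -!cards_draws.
rewrite -(cardsID [set I : {set 'I_n} | [disjoint I & S]]
   [set A : {set 'I_n} | A \subset [set: 'I_n] & #|A| == 2]).
rewrite addnC (_ : #|_ :&: _| = #|[set A : {set 'I_n} | A \subset ~: S & #|A| == 2]|).
  by rewrite addnK; apply: eq_card => I; rewrite !inE subsetT andbC.
by apply: eq_card => I; rewrite !inE subsetT /= -setD_eq0 setDE setCK setI_eq0 andbC.
Qed.

Lemma meets_of_dist I y c : dist (~: I) y c < hamming y c ->
  ~~ [disjoint I & [set l | y l != c l]].
Proof.
apply: contraL => dis; rewrite -leqNgt (hamming_split I).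
rewrite [dist I y c](_ : _ = 0) //; apply/eqP; rewrite cards_eq0 -subset0.
apply/subsetP=> l; rewrite inE => /andP[lI ne].
by have := disjointFr dis lI; rewrite inE ne.
Qed.

End Counting.

(** * Overlaps inside a plane *)

Section Excess.
Variables (q n R : nat).
Hypotheses (q_gt2 : 2 < q) (R_gt1 : 1 < R).
Implicit Types (w x y c : word q n) (B I S : {set 'I_n}).

Lemma two_others (s : 'I_q) : exists a b : 'I_q, [/\ a != s, b != s & a != b].
Proof.
have: 1 < #|predC1 s| by rewrite cardC1 card_ord; case: q q_gt2 s => [|[]].
by case/card_gt1P => a [b [aP bP ab]]; exists a, b.
Qed.

(** Here [s] and [t] are the restrictions to a plane of two codewords, and [e]
    is the radius left to the first one: a cross for [e = 1] and the whole
    plane for [e = 2]. Only points at distance exactly [e] from [s] are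
    counted. When [e = 1] and both coordinates differ, these are just the two
    points where the crosses meet; in the other cases a free coordinate of
    [s] leaves at least [q.-1 >= 2] choices. *)
Lemma grid_overlap (s1 s2 t1 t2 : 'I_q) e : 0 < e <= 2 ->
  1 < #|[set u : 'I_q * 'I_q | (u.1 != s1) + (u.2 != s2) == e
                             & (u.1 != t1) + (u.2 != t2) <= e]|.
Proof.
case/andP=> e_gt0 e_le2; apply/card_gt1P.
have [a [a' [as1 a's1 aa']]] := two_others s1.
have [b [b' [bs2 b's2 bb']]] := two_others s2.
have [->|e1] : e = 2 \/ e = 1 by case: e e_gt0 e_le2 => [|[|[|]]]; auto.
  exists (a, b), (a', b); rewrite !inE /= as1 a's1 bs2 xpair_eqE (negPf aa').
  by split=> //; [case: (a == t1) | case: (a' == t1)]; case: (b == t2).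
rewrite {}e1; have [<-|st1] := eqVneq s1 t1.
  exists (s1, b), (s1, b'); rewrite !inE /= eqxx bs2 b's2 xpair_eqE (negPf bb').
  by split; rewrite //= ?leq_b1 ?eqxx.
have [<-|st2] := eqVneq s2 t2.
  exists (a, s2), (a', s2); rewrite !inE /= eqxx as1 a's1 xpair_eqE (negPf aa').
  by split; rewrite //= ?addn0 ?leq_b1.
exists (t1, s2), (s1, t2); rewrite !inE /= !eqxx /= (eq_sym t1) (eq_sym t2).
by rewrite st1 st2 xpair_eqE (eq_sym t1) (negPf st1).
Qed.

(** A plane in direction [I] is named by its word that agrees with [o] on [I]. *)
Variable o : word q n.

Definition clear I y : word q n := [ffun l => if l \in I then o l else y l].

Lemma dist_clear I y c : dist (~: I) (clear I y) c = dist (~: I) y c.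
Proof.
by rewrite !dist_sum; apply: eq_bigr => l; rewrite inE ffunE => /negPf ->.
Qed.

(** The reserve [e] of [c] in the plane of [w] is [R - dist (~: I) w c], which is
    [1] or [2]; as [c'] is at least as close to the plane, its reserve is at
    least [e], so [grid_overlap] applies. *)
Lemma plane_overlap I w c c' : #|I| = 2 -> [forall l in I, w l == o l] ->
    dist (~: I) w c' <= dist (~: I) w c -> R - 2 <= dist (~: I) w c < R ->
  1 < #|[set y | clear I y == w & (hamming y c' <= R) && (hamming y c == R)]|.
Proof.
case/eqP/cards2P=> i [j [ij ->]] /forallP wo; set B := ~: _ => c'c /andP[cR cR'].
pose f (u : 'I_q * 'I_q) : word q n :=
  [ffun l => if l == i then u.1 else if l == j then u.2 else w l].
have f_i u : f u i = u.1 by rewrite ffunE eqxx.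
have f_j u : f u j = u.2 by rewrite ffunE eq_sym (negPf ij) eqxx.
have f_inj : injective f.
  by move=> u v uv; apply/eqP; rewrite -pair_eqE /= -!f_i -!f_j uv !eqxx.
have f_w u : clear [set i; j] (f u) = w.
  apply/ffunP=> l; have := wo l; rewrite !ffunE !inE.
  by case: eqP => [->|_] /=; [move/eqP | case: eqP => // -> /eqP].
have f_d u x : hamming (f u) x = (u.1 != x i) + (u.2 != x j) + dist B w x.
  rewrite (hamming_split [set i; j]) -dist_clear f_w; congr addn.
  by rewrite dist_sum big_setU1 ?inE //= big_set1 f_i f_j.
have e_ok : 0 < R - dist B w c <= 2 by rewrite subn_gt0 cR' leq_subCl.
apply: leq_trans (grid_overlap (c i) (c j) (c' i) (c' j) e_ok) _.
rewrite -(card_imset _ f_inj); apply/subset_leq_card/subsetP=> _ /imsetP[u + ->].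
rewrite !inE f_w eqxx !f_d /= => /andP[/eqP -> le2]; rewrite subnK ?(ltnW cR') //.
by rewrite eqxx andbT (leq_trans (leq_add le2 c'c)) // subnK ?(ltnW cR').
Qed.

Variable C : {set word q n}.
Hypothesis covC : covering R C.

Lemma nearest_outside : exists psi : {set 'I_n} -> word q n -> word q n,
  forall I w, psi I w \in C /\
    {in C, forall c, dist (~: I) w (psi I w) <= dist (~: I) w c}.
Proof.
have [c0 c0C] : exists c, c \in C.
  by have /existsP[c /andP[cC _]] := forallP covC o; exists c.
exists (fun I w => [arg min_(c < c0 in C) dist (~: I) w c]) => I w.
by case: arg_minnP.
Qed.

(** * The surplus, by planes and by words *)

Variable psi : {set 'I_n} -> word q n -> word q n.
Hypothesis psiP : forall I w, psi I w \in C /\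
  {in C, forall c, dist (~: I) w (psi I w) <= dist (~: I) w c}.

Let D := pairs_meeting n R.
Let M := near_planes q n R.

(** The codewords seen from direction [I] to cover [y] redundantly. They are
    restricted to distance exactly [R] from [y] since closer ones could
    be seen from every direction, and the codeword of reference is attached to the
    plane of [y], not to [y], so that each plane loses a single codeword. *)
Definition surplus I y := [set c in C |
  [&& c != psi I (clear I y), hamming y (psi I (clear I y)) <= R,
      hamming y c == R & R - 2 <= dist (~: I) y c < R]].

(** The codeword of reference [psi] varies with [I]. It is traded for a fixed
    codeword [phi] nearest to [y]: if [phi] is closer than [R] it is not in
    [Z I] at all, and otherwise [psi] lies in [Z I] whenever there is any
    surplus, so removing [phi] from [Z I] instead of [psi] leaves at least as
    many codewords. Each [c] other than [phi] covering [y] is then in [Z I] for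
    at most [D] directions. *)
Lemma point_surplus y :
  \sum_(I : {set 'I_n} | #|I| == 2) #|surplus I y| + D <=
  D * #|[set c in C | hamming y c <= R]|.
Proof.
have [c0 c0C _] : exists2 c, c \in C & hamming y c <= R.
  by have /existsP[c /andP[cC cR]] := forallP covC y; exists c.
have [phi phiC phi_min] : exists2 phi, phi \in C &
    {in C, forall c, hamming y phi <= hamming y c}.
  by exists [arg min_(c < c0 in C) hamming y c]; case: arg_minnP.
have phiR : hamming y phi <= R.
  have /existsP[c /andP[cC]] := forallP covC y.
  exact/leq_trans/phi_min.
pose Z I := [set c in C | (hamming y c == R) &&
  ~~ [disjoint I & [set l | y l != c l]]].
have surplus_le I : #|surplus I y| <= #|Z I :\ phi|.
  have [psiC psi_min] := psiP I (clear I y).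
  have subZ : surplus I y \subset Z I :\ psi I (clear I y).
    apply/subsetP=> c; rewrite !inE => /and5P[-> -> _ /eqP cR /andP[_ lt_cR]] /=.
    by rewrite cR eqxx meets_of_dist // cR.
  have [phi_lt|phi_ge] := ltnP (hamming y phi) R.
    apply/subset_leq_card/subsetP=> c /(subsetP subZ).
    rewrite !inE => /and4P[_ -> /eqP cR ->]; rewrite cR eqxx !andbT.
    by apply: contraTneq phi_lt => <-; rewrite cR ltnn.
  have [->|[c]] := set_0Vmem (surplus I y); first by rewrite cards0.
  rewrite !inE => /and5P[cC _ psiR _ /andP[_ c_lt]].
  (* Some surplus codeword [c] exists and [psi] is no farther from the plane
     than [c], hence [psi] also differs from [y] inside [I]. *)
  have psiZ : psi I (clear I y) \in Z I.
    have psi_eq : hamming y (psi I (clear I y)) = R.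
      by apply/eqP; rewrite eqn_leq psiR (leq_trans phi_ge) ?phi_min.
    rewrite !inE psiC psi_eq eqxx meets_of_dist //.
    rewrite psi_eq -(dist_clear I) (leq_ltn_trans (psi_min c cC)) //.
    by rewrite dist_clear.
  apply: leq_trans (subset_leq_card subZ) _; rewrite -ltnS.
  have := cardsD1 (psi I (clear I y)) (Z I); rewrite psiZ add1n => <-.
  by rewrite (cardsD1 phi (Z I)); case: (phi \in Z I).
have A_phi : phi \in [set c in C | hamming y c <= R] by rewrite inE phiC.
rewrite (cardsD1 phi) A_phi mulnDr muln1 addnC leq_add2l.
apply: leq_trans (_ : \sum_(I : {set 'I_n} | #|I| == 2)
  \sum_(c in [set c in C | hamming y c <= R] :\ phi)
    ((hamming y c == R) && ~~ [disjoint I & [set l | y l != c l]]) <= _).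
  apply: leq_sum => I _; apply: leq_trans (surplus_le I) _.
  rewrite -sum1_card big_mkcond [in leqRHS]big_mkcond.
  apply: leq_sum => c _; rewrite !inE.
  by case: eqP => //= _; case: (c \in C) => //=; case: eqP => [->|]; rewrite ?leqnn.
rewrite exchange_big /= -sum1_card big_distrr /=; apply: leq_sum => c _.
have [cR|] := eqP; last by rewrite big1.
have := card_pairs_meeting [set l | y l != c l].
rewrite -/(hamming y c) cR -/D muln1 => <-.
by rewrite -sum1_card -big_mkcondr leq_eqVlt; apply/orP; left; apply/eqP;
  apply: eq_bigl => I; rewrite inE.
Qed.

(** In each plane all near codewords, except possibly the codeword of reference,
    contribute at least two surplus incidences by [plane_overlap]; the term [2 * q ^ (n - 2)] pays for
    these exceptions. *)
Lemma plane_surplus I : #|I| = 2 ->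
  2 * (#|C| * M) <= \sum_y #|surplus I y| + 2 * q ^ (n - 2).
Proof.
move=> I2; have cI2 : #|~: I| = n - 2 by rewrite cardsCs setCK card_ord I2.
pose base := [set w : word q n | [forall l in I, w l == o l]].
pose N w := [set c in C | R - 2 <= dist (~: I) w c < R].
have clear_base y : clear I y \in base.
  rewrite inE; apply/forallP=> l; apply/implyP=> lI.
  by rewrite ffunE lI.
have sum_N : #|C| * M = \sum_(w in base) #|N w|.
  have [m Rm] : exists m, R = m.+2 by exists (R - 2); rewrite -addn2 subnK.
  rewrite -sum_nat_const.
  under [RHS]eq_bigr => w _ do rewrite -sum1dep_card big_mkcondr.
  rewrite exchange_big /=; apply: eq_bigr => c _.
  rewrite -big_mkcondr /= sum1dep_card.
  have cardS d := card_sphere (~: I) o c d.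
  rewrite setCK cI2 in cardS.
  rewrite /M /near_planes -!cardS -cardsUI [X in _ + X](_ : _ = 0).
    rewrite addn0; apply: eq_card => w; rewrite !inE -andb_orr; congr andb.
    rewrite leq_eqVlt Rm !subSS !subn0 [_ == m.+1]eqn_leq eq_sym andbC.
    by case: eqP => [<-|_] /=; rewrite ?leqnSn ?ltnS.
  apply/eqP; rewrite cards_eq0; apply/eqP/setP=> w; rewrite !inE.
  apply/negP => /andP[/andP[_ /eqP ->] /andP[_]].
  by rewrite Rm !subSS !subn0 ltn_eqF.
rewrite sum_N -cI2 -(card_words_off _ o) setCK -/base -sum1_card !big_distrr /=.
rewrite [X in _ <= X + _](partition_big (clear I) (mem base)) => [/=|y _];
  last exact: clear_base.
rewrite -big_split /=; apply: leq_sum => w w_base; rewrite muln1.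
have [psiC psi_min] := psiP I w.
(* The codeword of reference may or may not be near; it costs at most [2]. *)
rewrite (cardsD1 (psi I w)) mulnDr addnC leq_add //; last by case: (_ \in _).
apply: leq_trans (_ : \sum_(c in N w :\ psi I w) \sum_(y | clear I y == w)
   (c \in surplus I y) <= _).
  rewrite mulnC -sum_nat_const; apply: leq_sum => c.
  rewrite !inE => /and3P[c_psi cC cR].
  rewrite inE in w_base.
  apply: leq_trans (plane_overlap I2 w_base (psi_min c cC) cR) _.
  rewrite -sum1dep_card big_mkcondr; apply: leq_sum => y /eqP yw.
  rewrite inE yw cC c_psi -(dist_clear I) yw cR.
  by case: (hamming y c == R); case: (hamming y (psi I w) <= R).
rewrite exchange_big; apply: leq_sum => y _ /=.
rewrite -sum1_card big_mkcond [in leqRHS]big_mkcond; apply: leq_sum => c _.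
by case: (c \in surplus I y); case: ifP.
Qed.

Lemma surplus_sum :
  'C(n, 2) * (2 * (#|C| * M)) + D * q ^ n <=
  D * (#|C| * \sum_(d < R.+1) 'C(n, d) * q.-1 ^ d) +
  'C(n, 2) * (2 * q ^ (n - 2)).
Proof.
pose A y := [set c in C | hamming y c <= R].
have sum_A : #|C| * (\sum_(d < R.+1) 'C(n, d) * q.-1 ^ d) = \sum_y #|A y|.
  rewrite -sum_nat_const.
  under [RHS]eq_bigr => y _ do rewrite -sum1dep_card big_mkcondr.
  rewrite [RHS]exchange_big; apply: eq_bigr => c _.
  by rewrite -(sum_ball R c) -big_mkcond.
have card_dirs : #|[set I : {set 'I_n} | #|I| == 2]| = 'C(n, 2).
  by rewrite -[n in 'C(n, 2)]card_ord -card_draws.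
have card_words : \sum_(y : word q n) D = D * q ^ n.
  by rewrite sum_nat_const card_ffun !card_ord mulnC.
apply: leq_trans (_ : \sum_(I : {set 'I_n} | #|I| == 2) \sum_y #|surplus I y| +
   'C(n, 2) * (2 * q ^ (n - 2)) + D * q ^ n <= _).
  rewrite leq_add2r -card_dirs -[_ * (2 * (_ * _))]sum_nat_const.
  rewrite -[_ * (2 * q ^ _)]sum_nat_const.
  rewrite (eq_bigl (fun I : {set 'I_n} => #|I| == 2)) => [|I]; last by rewrite inE.
  rewrite [X in _ + X](eq_bigl (fun I : {set 'I_n} => #|I| == 2)) => [|I];
    last by rewrite inE.
  rewrite -big_split; apply: leq_sum => I /eqP I2; exact: plane_surplus.
rewrite addnAC leq_add2r exchange_big -card_words -big_split sum_A big_distrr.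
by apply: leq_sum => y _; apply: point_surplus.
Qed.

End Excess.

(** This is the sphere covering inequality multiplied by [pairs_meeting n R] and
    improved, in each direction, by two for every near plane of every codeword
    less two for every plane. *)
Theorem covering_bound q n R (C : {set word q n}) :
    2 < q -> 1 < R -> covering R C ->
  'C(n, 2) * (2 * (#|C| * near_planes q n R)) + pairs_meeting n R * q ^ n <=
  pairs_meeting n R * (#|C| * \sum_(d < R.+1) 'C(n, d) * q.-1 ^ d)
    + 'C(n, 2) * (2 * q ^ (n - 2)).
Proof.
move=> q_gt2 R_gt1 covC; have q_gt0 : 0 < q by apply: leq_trans q_gt2.
pose o : word q n := [ffun=> Ordinal q_gt0].
have [psi psiP] := nearest_outside o covC.
exact: (surplus_sum q_gt2 R_gt1 o covC psiP).
Qed.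

(** * Evaluation in binary *)

Section Binary.
Local Open Scope N_scope.

Lemma nat_of_binD a b : nat_of_bin (a + b)%num = (a + b)%N.
Proof. by case: a b => [|a] [|b] //=; rewrite ?addn0 // nat_of_add_pos. Qed.

Lemma nat_of_binM a b : nat_of_bin (a * b)%num = (a * b)%N.
Proof. by case: a b => [|a] [|b] //=; rewrite ?muln0 // nat_of_mul_pos. Qed.

Lemma nat_of_bin_le a b : (a <=? b)%num -> (nat_of_bin a <= nat_of_bin b)%N.
Proof. by move/N.leb_le/N.sub_add <-; rewrite nat_of_binD leq_addl. Qed.

Definition powN (a : N) k : N := iter k (N.mul a) 1.

Lemma nat_of_powN a k : nat_of_bin (powN a k) = (a ^ k)%N.
Proof. by elim: k => //= k IH; rewrite nat_of_binM IH expnS. Qed.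

Definition binN n k : N := bin_of_nat 'C(n, k).

Definition ballN n R (p : N) : N :=
  foldr (fun d s => binN n d * powN p d + s) 0 (iota 0 R.+1).

Lemma nat_of_ballN n R p :
  nat_of_bin (ballN n R p) = (\sum_(d < R.+1) 'C(n, d) * p ^ d)%N.
Proof.
rewrite -(big_mkord xpredT (fun d => 'C(n, d) * p ^ d)%N) /index_iota subn0.
rewrite /ballN; elim: iota => [|d s IH]; first by rewrite big_nil.
by rewrite big_cons /= nat_of_binD nat_of_binM nat_of_powN bin_of_natK IH.
Qed.

(** The coefficient of [|C|] in [covering_bound] is nonnegative, and the
    inequality fails for [|C| = b - 1]; the terms of the latter are moved so
    that no subtraction occurs. *)
Definition excludes_below q n R (b : N) : bool :=
  let p := bin_of_nat q.-1 in
  let c := binN n 2 in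
  let D := bin_of_nat (pairs_meeting n R) in
  let M := binN (n - 2) (R - 2) * powN p (R - 2)
         + binN (n - 2) (R - 1) * powN p (R - 1) in
  let V := ballN n R p in
  (c * (2 * M) <=? D * V) &&
  (D * (b * V) + c * (2 * powN (bin_of_nat q) (n - 2)) + c * (2 * M) + 1
     <=? D * powN (bin_of_nat q) n + c * (2 * (b * M)) + D * V).

Lemma K_ge q n R b :
  [&& (2 < q)%N, (1 < R)%N & excludes_below q n R b] -> (b <= K q n R)%N.
Proof.
move=> /and3P[q_gt2 R_gt1 /andP[/nat_of_bin_le le1 /nat_of_bin_le le2]].
have [C covC <-] := covering_K q n R; rewrite leqNgt; apply/negP => Cb.
have := covering_bound q_gt2 R_gt1 covC.
move: le1 le2; rewrite !(nat_of_binD, nat_of_binM, nat_of_powN, nat_of_ballN).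
rewrite !bin_of_natK /= -/(near_planes q n R).
move: (_ ^ n)%N (_ ^ (n - 2))%N (\sum_(_ < _) _)%N => P Q V.
move: (near_planes q n R) (pairs_meeting n R) 'C(n, 2)%N => M D c.
have [t ->] : exists t, nat_of_bin b = (t.+1 + #|C|)%N.
  by exists (b - #|C|.+1)%N; rewrite addSnnS subnK.
move: #|C| => x le1 le2 le3.
have {}le1 := leq_mul (leqnn t) le1.
lia.
Qed.

End Binary.

(* The bounds are binary literals (type N), coerced to nat by ssrnat's
   nat_of_bin: the larger ones are impractical as unary numerals. *)
Theorem mainTheorem2 :
  K 6 8 2 >= 2367%num /\
  K 6 9 2 >= 10965%num /\
  K 6 9 3 >= 926%num /\
  K 6 10 3 >= 3836%num /\
  K 6 10 4 >= 441%num /\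
  K 7 7 2 >= 1081%num /\
  K 7 8 2 >= 5631%num /\
  K 7 8 3 >= 471%num /\
  K 7 9 2 >= 30562%num /\
  K 7 9 3 >= 2143%num /\
  K 7 10 2 >= 170632%num /\
  K 8 8 2 >= 12033%num /\
  K 8 8 3 >= 856%num /\
  K 8 9 4 >= 429%num /\
  K 9 8 2 >= 23642%num /\
  K 9 8 3 >= 1464%num /\
  K 9 9 3 >= 8685%num /\
  K 9 9 4 >= 722%num /\
  K 9 10 3 >= 54600%num /\
  K 10 7 2 >= 5824%num /\
  K 10 8 2 >= 43423%num /\
  K 10 9 2 >= 337394%num /\
  K 10 9 4 >= 1160%num /\
  K 10 10 2 >= 2699348%num /\
  K 10 10 4 >= 6915%num /\
  K 11 7 2 >= 9193%num /\
  K 11 8 2 >= 75448%num /\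
  K 12 8 2 >= 125156%num /\
  K 12 8 3 >= 5605%num /\
  K 13 6 2 >= 2233%num /\
  K 13 7 2 >= 20545%num /\
  K 13 8 2 >= 199633%num /\
  K 13 8 3 >= 8193%num /\
  K 14 6 2 >= 2964%num /\
  K 14 7 2 >= 29404%num /\
  K 14 8 2 >= 307909%num /\
  K 15 6 2 >= 3862%num /\
  K 15 8 2 >= 461294%num /\
  K 16 6 2 >= 4951%num /\
  K 16 7 2 >= 56237%num /\
  K 16 8 2 >= 673723%num /\
  K 17 7 2 >= 75559%num /\
  K 17 8 2 >= 962145%num /\
  K 17 8 3 >= 29652%num /\
  K 17 8 4 >= 1464%num /\
  K 18 6 2 >= 7804%num /\
  K 18 8 2 >= 1346931%num /\
  K 19 6 2 >= 9624%num /\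
  K 19 7 2 >= 130081%num /\
  K 19 7 3 >= 4282%num /\
  K 19 8 2 >= 1852296%num /\
  K 20 7 2 >= 167204%num /\
  K 20 7 3 >= 5215%num /\
  K 20 8 2 >= 2506759%num /\
  K 21 6 2 >= 14201%num /\
  K 21 7 3 >= 6294%num /\
  K 21 8 2 >= 3343629%num /\
  K 21 8 3 >= 82595%num.
Proof.
by do 57!(split; first by apply: K_ge; vm_compute); apply: K_ge; vm_compute.
Qed.
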